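(* Let $S$ be a nonempty set and let $\theta \subseteq \mathcal P(S) \times \mathcal P(S)$. Then $\theta$ is a transition system over $S$ if and only if there exists a decision game $\Gamma = (S, E, O)$ such that for all $X, Y \subseteq S$, \[ (X, Y) \in \theta \iff \Gamma : X \rightarrow Y. \]
   Context: A transition system over a nonempty set $S$ of states is a nonempty relation $\theta \subseteq \mathcal P(S) \times \mathcal P(S)$ such that: (Downwards closure) if $(X,Y)\in\theta$ and $X' \subseteq X$ then $(X',Y)\in\theta$; (Monotonicity) if $(X,Y)\in\theta$ and $Y \subseteq Y'$ then $(X,Y')\in\theta$; (Non-creation) $(\emptyset, Y)\in\theta$ for all $Y\subseteq S$; (Non-triviality) if $X\neq\emptyset$ then $(X,\emptyset)\notin\theta$. A decision game is a triple $\Gamma=(S,E,O)$ where $S$ is a nonempty set of states, $E$ is a nonempty set of decisions, and $O : S\times E \to \mathcal P(S)$ is an outcome function. For $X,Y\subseteq S$, we write $\Gamma : X\rightarrow Y$ (''$\Gamma$ allows the transition from $X$ to $Y$'') iff there exists $e\in E$ such that $\emptyset \neq O(s,e)\subseteq Y$ for all $s\in X$. *)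

(* Defs.v *)
From mathcomp Require Import all_boot.
From mathcomp Require Import boolp classical_sets.

Set Implicit Arguments.
Unset Strict Implicit.
Unset Printing Implicit Defensive.

Local Open Scope classical_set_scope.

Record transition_system (S : Type) (theta : set (set S * set S)) : Prop := {
  ts_states_nonempty : [set: S] !=set0;
  ts_nonempty : theta !=set0;
  ts_downwards_closure : forall X X' Y : set S,
    theta (X, Y) -> X' `<=` X -> theta (X', Y);
  ts_monotonicity : forall X Y Y' : set S,
    theta (X, Y) -> Y `<=` Y' -> theta (X, Y');
  ts_non_creation : forall Y : set S, theta (set0, Y);
  ts_non_triviality : forall X : set S, X <> set0 -> ~ theta (X, set0)
}.

(* The set of states is the parameter S; the set of decisions, being
   existentially quantified in the representation theorem, is a field. *)
Record decision_game (S : Type) := DecisionGame {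
  decision : Type;
  outcome : S * decision -> set S;
  game_states_nonempty : [set: S] !=set0;
  game_decisions_nonempty : [set: decision] !=set0
}.

Definition allows (S : Type) (G : decision_game S) (X Y : set S) : Prop :=
  exists e : decision G, forall s : S, X s ->
    outcome (s, e) <> set0 /\ outcome (s, e) `<=` Y.

(* Main.v *)
(** A transition system is realised by the game whose decisions are its own
    transitions: choosing [(A, B)] in [theta] leads from any state of [A] to the
    outcome set [B], and has no outcome at the states outside [A]. *)
Require Import Defs.
From mathcomp Require Import all_boot.
From mathcomp Require Import boolp classical_sets.

Local Open Scope classical_set_scope.

Section CanonicalGame.
Variables (S : Type) (theta : set (set S * set S)).
Hypothesis ts_theta : transition_system theta.

Definition canonical_outcome (se : S * {p | theta p}) : set S :=
  [set y | (sval se.2).1 se.1 /\ (sval se.2).2 y].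

Lemma canonical_decisions_nonempty : [set: {p | theta p}] !=set0.
Proof. by have [p thp] := ts_nonempty ts_theta; exists (exist _ p thp). Qed.

Definition canonical_game : decision_game S :=
  DecisionGame canonical_outcome
    (ts_states_nonempty ts_theta) canonical_decisions_nonempty.

(** A transition serves as its own decision, with non-triviality excluding empty outcomes.
    Conversely, a decision [(A, B)] that works on a nonempty [X] has [X] inside [A] and [B] inside
    [Y], so the two closure axioms carry it to [(X, Y)]. *)
Lemma canonical_gameP (X Y : set S) : theta (X, Y) <-> allows canonical_game X Y.
Proof.
split=> [thXY | [[[A B] /= thAB] hXY]].
  exists (exist _ (X, Y) thXY) => s Xs; split=> [out0 | y []] //.
  have Y0 : Y = set0.
    rewrite -subset0 => y Yy.
    by have : canonical_outcome (s, exist _ (X, Y) thXY) y by []; rewrite [X in X y]out0.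
  apply: (ts_non_triviality ts_theta (X := X)); last by rewrite -Y0.
  by move=> X0; move: Xs; rewrite X0.
(* For empty [X], [hXY] is vacuous and says nothing about [B]. *)
have [-> | /set0P[s Xs]] := eqVneq X set0; first exact: (ts_non_creation ts_theta).
(* Outside [A] the outcome is empty, which [hXY] forbids on [X]. *)
have sXA : X `<=` A by move=> t /hXY[/eqP/set0P[y []]].
apply: (ts_monotonicity ts_theta) (ts_downwards_closure ts_theta thAB sXA) _ => y By.
(* Since [s] lies in [A], its outcome is all of [B]. *)
by apply: (hXY s Xs).2; split=> //; exact: sXA.
Qed.

End CanonicalGame.

(** Non-creation holds because any decision works vacuously on the empty set; non-triviality because
    a nonempty outcome cannot lie in [set0]. *)
Lemma allows_transition_system (S : Type) (G : decision_game S) :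
  transition_system [set p | allows G p.1 p.2].
Proof.
have [e0 _] := game_decisions_nonempty G.
have allows0 Y : allows G set0 Y by exists e0.
split=> /=.
- exact: (game_states_nonempty G).
- by exists (set0, set0); exact: allows0.
- by move=> X X' Y [e he] sX; exists e => s /sX; exact: he.
- move=> X Y Y' [e he] sY; exists e => s /he[ne sub].
  by split=> //; exact: subset_trans sub sY.
- exact: allows0.
- move=> X /eqP/set0P[s Xs] [e /(_ s Xs)[ne]].
  by rewrite subset0.
Qed.

Theorem mainTheorem1 (S : Type) (hS : [set: S] !=set0)
  (theta : set (set S * set S)) :
  transition_system theta <->
  exists G : decision_game S,
    forall X Y : set S, theta (X, Y) <-> allows G X Y.
Proof.
split=> [ts | [G hG]].
  by exists (canonical_game S theta ts) => X Y; exact: canonical_gameP.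
suff -> : theta = [set p | allows G p.1 p.2] by exact: allows_transition_system.
by apply/predeqP => -[X Y]; exact: hG.
Qed.
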